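(* Let $n\ge 3$ be an integer. For every integer $\ell$ with $2\leq \ell \leq n-1$, $e_n(n,\ell,n-1)=n-1$.
   Context: All graphs are finite, simple and undirected; $e(G)$ is the number of edges of $G$ and $\Delta(G)$ its maximum degree. For a graph $G$ and a nonempty set $S\subseteq V(G)$, the Steiner distance $d_G(S)$ is the minimum number of edges of a connected subgraph of $G$ whose vertex set contains $S$, with $d_G(S)=\infty$ if there is no such subgraph. For $2\le k\le n=|V(G)|$, the Steiner $k$-diameter is $sdiam_k(G)=\max\{d_G(S) : S\subseteq V(G),\ |S|=k\}$ (so it is $\infty$ if some $k$-set lies in no connected subgraph). For natural numbers $n,\ell,d$ with $\ell<n$ and $d<n$, $\mathscr{H}_k(n,\ell,d)$ is the set of all graphs $G$ of order $n$ with maximum degree exactly $\ell$ and $sdiam_k(G)\le d$, and $e_k(n,\ell,d)=\min\{e(G): G\in\mathscr{H}_k(n,\ell,d)\}$, with $e_k(n,\ell,d)=\infty$ if $\mathscr{H}_k(n,\ell,d)$ is empty. *)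

(* Defs.v *)
From HB Require Import structures.
From mathcomp Require Import all_boot all_order all_algebra.
From mathcomp Require Import constructive_ereal.

Set Implicit Arguments.
Unset Strict Implicit.
Unset Printing Implicit Defensive.

Import Order.TTheory GRing.Theory Num.Theory.

Local Open Scope nat_scope.

Section Graphs.

Variable V : finType.

(* Every edge is a set of exactly two vertices: there are neither loops nor
   multiple edges, and the graphs on V form a finite type. *)
Record graph := Graph {
  edges : {set {set V}};
  edges_card2 : [forall e in edges, #|e| == 2]
}.

HB.instance Definition _ := [isSub for edges].
HB.instance Definition _ := [Finite of graph by <:].

Definition adj (G : graph) : rel V := fun x y => [set x; y] \in edges G.

Definition num_edges (G : graph) : nat := #|edges G|.

Definition degree (G : graph) (x : V) : nat := #|[set y | adj G x y]|.

Definition max_degree (G : graph) : nat := \max_(x : V) degree G x.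

(* The pair (W, F) stands for the subgraph of G with vertex set W and edge
   set F; the endpoints of the edges in F must then belong to W. *)
Definition subgraph (H : {set V} * graph) (G : graph) : bool :=
  (edges H.2 \subset edges G) && [forall e in edges H.2, e \subset H.1].

Definition connected (H : {set V} * graph) : bool :=
  (H.1 != set0) && [forall x in H.1, forall y in H.1, connect (adj H.2) x y].

(* Quantities that may be infinite live in \bar int; the minimum of an empty
   family is +oo. *)
Definition steiner_dist (G : graph) (S : {set V}) : \bar int :=
  (\big[mine/+oo]_(H : {set V} * graph |
       [&& subgraph H G, connected H & S \subset H.1])
     (num_edges H.2)%:Z%:E)%E.

(* The index 0 is harmless: Steiner distances are nonnegative, and there is a
   set of size k as soon as k <= #|V|. *)
Definition sdiam (k : nat) (G : graph) : \bar int :=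
  (\big[maxe/0]_(S : {set V} | #|S| == k) steiner_dist G S)%E.

End Graphs.

(* Graphs of order n are taken on the vertex set 'I_n. *)
Definition steiner_graphs (k n l d : nat) : {set graph 'I_n} :=
  [set G : graph 'I_n |
    (max_degree G == l) && (sdiam k G <= d%:Z%:E)%E].

Definition min_size (k n l d : nat) : \bar int :=
  (\big[mine/+oo]_(G in steiner_graphs k n l d) (num_edges G)%:Z%:E)%E.

(* Main.v *)
Require Import Defs.
From mathcomp Require Import all_boot all_order all_algebra.
From mathcomp Require Import constructive_ereal.

(** For k = n the only n-set is the whole vertex set, so a finite Steiner
    n-diameter just says that the graph is connected; growing a vertex set along
    crossing edges then yields n - 1 edges. Equality is attained by the broom:
    a star with centre 0 and leaves 1, ..., l, one of which is prolonged by the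
    path l, l + 1, ..., n - 1. *)

Set Implicit Arguments.
Unset Strict Implicit.
Unset Printing Implicit Defensive.

Import Order.TTheory.

Lemma adj_sym (V : finType) (G : graph V) : symmetric (adj G).
Proof. by move=> x y; rewrite /adj setUC. Qed.

(** If no edge left [A], then [A] would be closed under adjacency, hence a union of components, and
    could not separate [r] from [y]. *)
Lemma crossing_edge (V : finType) (G : graph V) (A : {set V}) (r y : V) :
  connect (adj G) r y -> r \in A -> y \notin A ->
  exists u, exists2 v, u \in A /\ v \notin A & adj G u v.
Proof.
move=> ry rA yA.
have [/exists_inP[u uA /exists_inP[v vA uv]]|none] :=
  boolP [exists u in A, exists v in ~: A, adj G u v].
  by exists u, v => //; rewrite inE in vA.
suff clA : closed (adj G) A.
  by move: (closed_connect clA ry); rewrite rA (negPf yA).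
apply: intro_closed => [|u v uv uA].
  exact: sym_connect_sym (adj_sym G).
apply: contraNT none => vA; apply/exists_inP; exists u => //.
by apply/exists_inP; exists v; rewrite ?inE.
Qed.

Lemma connected_num_edges (V : finType) (G : graph V) :
  (forall x y, connect (adj G) x y) -> #|V| - 1 <= num_edges G.
Proof.
move=> conn; have [/eqP V0|] := posnP #|V|; first by rewrite (eqP V0).
case/card_gt0P=> r _.
have grow k : k < #|V| -> exists2 A : {set V},
    r \in A /\ #|A| = k.+1 & k <= #|[set e in edges G | e \subset A]|.
  elim: k => [|k IHk] kV.
    by exists [set r]; rewrite ?cards1 ?set11.
  have [A [rA cA] leA] := IHk (ltnW kV).
  have [y yA] : exists y, y \notin A.
    apply/existsP; rewrite -negb_forall; apply: contraL kV => /forallP allA.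
    by rewrite -leqNgt -cA; apply/subset_leq_card/subsetP=> x _; apply: allA.
  have [u [v [uA vA] uv]] := crossing_edge (conn r y) rA yA.
  exists (v |: A); first by rewrite !inE rA orbT cardsU1 vA cA.
  (* The crossing edge lies inside [v |: A] but not inside [A], so the number of inner edges
     strictly increases. *)
  rewrite -ltnS in leA; apply: leq_trans leA _; apply: proper_card.
  apply/properP; split.
    apply/subsetP=> e; rewrite !inE => /andP[-> eA] /=.
    exact: subset_trans eA (subsetUr _ _).
  exists [set u; v]; rewrite !inE (_ : _ \in edges G) //=.
    by rewrite subUset !sub1set !inE uA eqxx orbT.
  by rewrite subUset !sub1set (negPf vA) andbF.
have V0 : 0 < #|V| by apply/card_gt0P; exists r.
have [|A _ leA] := grow #|V|.-1; first by rewrite prednK.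
rewrite subn1; apply: leq_trans leA _; apply: subset_leq_card.
by apply/subsetP=> e; rewrite inE => /andP[].
Qed.

Lemma sdiam_order_finite_connected (n d : nat) (G : graph 'I_n) :
  (sdiam n G <= d%:Z%:E)%E -> forall x y, connect (adj G) x y.
Proof.
move=> Gd.
have : (steiner_dist G setT <= d%:Z%:E)%E.
  apply: le_trans Gd; rewrite /sdiam; apply: le_bigmax_cond.
  by rewrite cardsT card_ord.
rewrite /steiner_dist; case: (pickP (fun H : {set 'I_n} * graph 'I_n =>
   [&& subgraph H G, connected H & setT \subset H.1])) => [H|H0]; last first.
  (* Without a connected spanning subgraph the minimum is the default [+oo], which exceeds the
     finite bound. *)
  by rewrite (big_pred0 _ _ _ _ H0).
case/and3P=> /andP[HG _] /andP[_ /forall_inP Hc] /subsetP H1 _ x y.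
have /forall_inP/(_ y (H1 y _)) := Hc x (H1 x (in_setT x)).
rewrite inE => /(_ isT); apply: connect_sub => u v uv.
by apply: connect1; apply: (subsetP HG).
Qed.

(** The whole graph is itself a connected subgraph containing any [S]. *)
Lemma sdiam_order_connected (n : nat) (G : graph 'I_n.+1) :
  (forall x y, connect (adj G) x y) ->
  (sdiam n.+1 G <= (num_edges G)%:Z%:E)%E.
Proof.
move=> conn; apply: bigmax_le => // S _.
apply: (@bigmin_le_cond _ _ _ _ (setT, G)); apply/and3P; split => /=.
- rewrite /subgraph /= subxx; apply/forall_inP => e _; exact: subsetT.
- rewrite /connected /=; apply/andP; split.
    by apply/set0Pn; exists ord0.
  by apply/forall_inP => x _; apply/forall_inP => y _; apply: conn.
- exact: subsetT.
Qed.

Section Broom.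

Variables (m l : nat).

(** The broom is encoded as a tree rooted at 0 through its parent map. The root is sent to itself,
    so only the other vertices contribute edges; on those the map strictly decreases labels. *)
Definition broom_parent (i : 'I_m.+1) : 'I_m.+1 :=
  if i <= l then ord0 else inord i.-1.

Lemma val_broom_parent i : broom_parent i = (if i <= l then 0 else i.-1) :> nat.
Proof.
rewrite /broom_parent; case: ifP => //= _; rewrite inordK //.
exact: leq_ltn_trans (leq_pred i) (ltn_ord i).
Qed.

Lemma broom_parent_lt i : i != ord0 -> broom_parent i < i.
Proof.
rewrite -val_eqE /= val_broom_parent -lt0n => i0; case: ifP => // _.
by rewrite prednK.
Qed.

Lemma broom_parent_neq i : i != ord0 -> broom_parent i != i.
Proof. by move/broom_parent_lt; rewrite ltn_neqAle => /andP[]. Qed.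

Definition broom_edges : {set {set 'I_m.+1}} :=
  [set [set i; broom_parent i] | i in [set~ ord0]].

Lemma broom_edges_card2 : [forall e in broom_edges, #|e| == 2].
Proof.
apply/forall_inP => e /imsetP[i]; rewrite !inE => /broom_parent_neq i0 ->.
by rewrite cards2 [i == _]eq_sym i0.
Qed.

Definition broom : graph 'I_m.+1 := Graph broom_edges_card2.

Lemma adj_broom x y :
  adj broom x y = (x != ord0) && (y == broom_parent x)
               || (y != ord0) && (x == broom_parent y).
Proof.
apply/imsetP/idP => [[i i0 E]|/orP[]/andP[z0 /eqP ->]]; last 2 first.
- by exists x; rewrite ?inE.
- by exists y; rewrite ?inE // setUC.
rewrite !inE in i0; have /negPf pi := broom_parent_neq i0.
have xE : x \in [set i; broom_parent i] by rewrite -E !inE eqxx.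
have iE : i \in [set x; y] by rewrite E !inE eqxx.
have pE : broom_parent i \in [set x; y] by rewrite E !inE eqxx orbT.
move: xE iE pE; rewrite !inE => /orP[]/eqP ->.
  by rewrite i0 pi /= => _ /eqP ->; rewrite eqxx.
rewrite [i == _]eq_sym pi /= => /eqP <- _.
by rewrite i0 eqxx orbT.
Qed.

(** An edge determines its child endpoint: two distinct children with the same edge would be parents
    of each other, against the decrease of labels. *)
Lemma num_edges_broom : num_edges broom = m.
Proof.
rewrite /num_edges /= card_in_imset ?cardsC1 ?card_ord // => i j.
rewrite !inE => /broom_parent_lt pi /broom_parent_lt pj /setP E.
have := E i; have := E j; rewrite !inE !eqxx /=.
case: (eqVneq i j) => //= _ /eqP ji /esym/eqP ij.
by move: pi pj; rewrite -ji -ij => /ltn_trans/[apply]; rewrite ltnn.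
Qed.

Lemma broom_connected x y : connect (adj broom) x y.
Proof.
have root (i : 'I_m.+1) : connect (adj broom) i ord0.
  (* Strong induction on the label: repeated passage to the parent descends to the root. *)
  have [k] := ubnP i; elim: k i => // k IHk i ik.
  case: (eqVneq i ord0) => [->|i0]; first exact: connect0.
  apply: connect_trans (IHk (broom_parent i) _).
    by apply: connect1; rewrite adj_broom i0 eqxx.
  exact: leq_trans (broom_parent_lt i0) _.
by apply: connect_trans (root x) _; rewrite (sym_connect_sym (@adj_sym _ _)).
Qed.

Lemma max_degree_broom : 2 <= l <= m -> max_degree broom = l.
Proof.
case/andP=> l2 lm.
have deg0 : degree broom ord0 = l.
  (* The neighbours of 0 are 1, ..., [l]: the lift shifts 0, ..., [l] - 1 up by one. *)
  rewrite /degree; transitivity #|[set lift ord0 (widen_ord lm i) | i : 'I_l]|.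
    apply: eq_card => y; rewrite inE adj_broom eqxx /=.
    rewrite -!val_eqE /= val_broom_parent.
    apply/andP/imsetP => [[y0 py]|[i _ ->]]; last first.
      by rewrite /= /bump /= add1n ltn_ord.
    have yl : y <= l.
      (* Beyond [l] the parent is the predecessor, which is nonzero. *)
      rewrite leqNgt; apply: contraL py => ly; rewrite leqNgt ly /=.
      by case: (val y) (leq_ltn_trans l2 ly) => [|[|k]].
    have yl' : y.-1 < l by case: (val y) y0 yl.
    exists (Ordinal yl') => //; apply: val_inj => /=.
    by rewrite /bump /= add1n prednK // lt0n.
  rewrite card_imset ?card_ord // => i j /lift_inj/(congr1 val) /= ij.
  exact: val_inj.
apply/eqP; rewrite eqn_leq; apply/andP; split; last first.
  by rewrite -{1}deg0; apply: leq_bigmax.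
apply/bigmax_leqP => x _; case: (eqVneq x ord0) => [->|x0]; first by rewrite deg0.
apply: leq_trans l2; rewrite /degree.
(* Apart from its parent, a nonroot [x] can only have the neighbour [x.+1], so its degree is at most
   2, hence at most [l]. For [x] = [m] the [inord] takes a default value, harmless in an upper
   bound. *)
apply: (@leq_trans #|[set broom_parent x; inord x.+1]|); last first.
  by rewrite cards2; case: eqP.
apply/subset_leq_card/subsetP => y; rewrite !inE adj_broom x0 /=.
case/orP=> [->//|/andP[y0 /eqP xy]]; apply/orP; right; apply/eqP/val_inj.
have py : x = y.-1 :> nat.
  move: x0; rewrite -val_eqE /= xy val_broom_parent.
  by case: ifP.
by rewrite /= py prednK ?inordK // lt0n.
Qed.

End Broom.

Theorem proposition2p1 :
  forall n : nat, (3 <= n)%N ->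
  forall l : nat, (2 <= l <= n - 1)%N ->
  min_size n n l (n - 1) = ((n - 1)%N%:Z%:E)%E.
Proof.
case=> // m _ l; rewrite subn1 /= => lm.
apply/eqP; rewrite eq_le; apply/andP; split.
  apply: (@bigmin_inf _ _ _ _ (broom m l)); last by rewrite num_edges_broom.
  rewrite inE max_degree_broom // eqxx /=.
  have := sdiam_order_connected (@broom_connected m l).
  by rewrite num_edges_broom.
(* The lower bound must also hold for the default [+oo] of the minimum. *)
apply: le_bigmin => [|G]; first exact: leey.
rewrite inE => /andP[_ /sdiam_order_finite_connected/connected_num_edges].
by rewrite card_ord subn1 lee_fin lez_nat.
Qed.
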